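(* Let $N\ge2$, let $a_N=\frac{\beta}{2}\mathsf{a}_N$ with $\mathsf{a}_N\ne0$ a fixed real number, and let $\boldsymbol{\mu}=(\mu_1>\cdots>\mu_{N-1})$ be fixed and not depend on $\beta$. For each $\beta>0$ let $\boldsymbol{\lambda}=(\lambda_1\ge\cdots\ge\lambda_N)$ be the ordered $N$ roots of the random equation $$\sum_{i=1}^{N-1}\frac{\xi_i}{x-\mu_i}=x-\xi_N,$$ where $\xi_1,\ldots,\xi_N$ are independent, $\xi_i\sim\frac12\chi_\beta^2$ for $i=1,\ldots,N-1$, and $\xi_N\sim\mathcal{N}(a_N,1)$. Then, as $\beta\to\infty$: (i) $N-1$ of the roots stay bounded and converge in probability to the roots of $$\sum_{i=1}^{N-1}\frac{1}{x-\mu_i}=-\mathsf{a}_N,\qquad\text{that is,}\qquad P_{\boldsymbol{\mu}}'(x)+\mathsf{a}_NP_{\boldsymbol{\mu}}(x)=0.$$ Of these $N-1$ limiting roots, exactly $N-2$ interlace with $\boldsymbol{\mu}$, one in each gap $(\mu_{i+1},\mu_i)$, and the last lies outside the range of $\boldsymbol{\mu}$: below $\mu_{N-1}$ if $\mathsf{a}_N>0$, and above $\mu_1$ if $\mathsf{a}_N<0$. (ii) The remaining root escapes on the scale of the perturbation: $\frac{2}{\beta}\max_j|\lambda_j|\to|\mathsf{a}_N|$ in probability, the unbounded root having the sign of $\mathsf{a}_N$ (with probability tending to $1$).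
   Context: $P_{\boldsymbol{\mu}}(x)=\prod_{i=1}^{N-1}(x-\mu_i)$. The law $\frac12\chi^2_\beta$ (chi-squared with real parameter $\beta>0$, halved) is the Gamma distribution with density $\Gamma(\beta/2)^{-1}x^{\beta/2-1}e^{-x}$ on $x>0$. The equation is equivalent, after clearing denominators, to $\prod_{i=1}^{N-1}(x-\mu_i)(x-\xi_N)-\sum_{i=1}^{N-1}\xi_i\prod_{k\ne i}(x-\mu_k)=0$; its $N$ roots are real. (The resulting law of $\boldsymbol{\lambda}$ is the conditional law of the top row given the next row $\boldsymbol{\mu}$ in the perturbed Gaussian $\beta$-corners process.) *)

(* Defs.v *)
From HB Require Import structures.
From mathcomp Require Export all_boot all_order all_algebra.
From mathcomp Require Export all_classical all_reals all_analysis.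

Set Implicit Arguments.
Unset Strict Implicit.
Unset Printing Implicit Defensive.

Import Order.TTheory GRing.Theory Num.Theory.
Import numFieldNormedType.Exports.

Local Open Scope classical_set_scope.
Local Open Scope ring_scope.

Definition Gamma {R : realType} (s : R) : R :=
  \int[lebesgue_measure]_(x in `]0, +oo[) (x `^ (s - 1) * expR (- x)).

(* The law of (1/2) chi^2_beta, i.e. the Gamma law of shape beta / 2 and unit
   scale. *)
Definition half_chi2_pdf {R : realType} (beta x : R) : R :=
  (Gamma (beta / 2))^-1 * x `^ (beta / 2 - 1) * expR (- x).

Definition half_chi2_prob {R : realType} (beta : R) (A : set R) : \bar R :=
  \int[lebesgue_measure]_(x in A `&` `]0, +oo[) (half_chi2_pdf beta x)%:E.

Definition has_law d (T : measurableType d) (R : realType)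
    (P : probability T R) (X : {RV P >-> R}) (law : set R -> \bar R) : Prop :=
  forall A : set R, measurable A -> distribution P X A = law A.

Definition mutually_independent d (T : measurableType d) (R : realType)
    (P : probability T R) (I : finType) (X : I -> {RV P >-> R}) : Prop :=
  forall (J : {set I}) (B : I -> set R), (forall i, measurable (B i)) ->
    P [set w | forall i, i \in J -> B i (X i w)] =
    (\prod_(i in J) P (X i @^-1` B i))%E.

(* A real index b tends to +oo; every b has its own probability space, as
   convergence in probability to a constant does not depend on a coupling. *)
Definition prob_tends_to_1 (R : realType) d (T : R -> measurableType d)
    (P : forall b, probability (T b) R) (E : forall b, set (T b)) : Prop :=
  P b (E b) @[b --> +oo] --> 1%E.

Definition cvg_in_probability (R : realType) d (T : R -> measurableType d)
    (P : forall b, probability (T b) R) (X : forall b, T b -> R) (c : R)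
    : Prop :=
  forall eps : R, 0 < eps ->
    P b [set w | eps <= `|X b w - c|] @[b --> +oo] --> 0%E.

(* The conditions x != mu i exclude the poles, where division by 0 would
   silently return 0.  The last entry of xi plays the role of xi_N. *)
Definition corner_equation (R : realType) (m : nat) (mu : 'I_m -> R)
    (xi : 'I_m.+1 -> R) (x : R) : Prop :=
  (forall i, x != mu i) /\
  \sum_(i < m) xi (widen_ord (leqnSn m) i) / (x - mu i) = x - xi ord_max.

Definition limit_equation (R : realType) (m : nat) (mu : 'I_m -> R) (a x : R)
    : Prop :=
  (forall i, x != mu i) /\ \sum_(i < m) 1 / (x - mu i) = - a.

Definition Pmu (R : realType) (m : nat) (mu : 'I_m -> R) : {poly R} :=
  \prod_(i < m) ('X - (mu i)%:P).

(* l_0 >= ... >= l_(k-1) are the solutions of E.  For E = corner_equation with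
   xi_i > 0 for i < N (an almost sure event) there are exactly N = k real
   solutions, all simple, so that l lists each of them exactly once. *)
Definition ordered_roots (R : realType) (k : nat) (E : R -> Prop)
    (l : 'I_k -> R) : Prop :=
  (forall i j : 'I_k, (i <= j)%N -> l j <= l i) /\
  (forall x, E x <-> exists j, x = l j).

(* Main.v *)
Require Import Defs.
From mathcomp Require Import measurable_realfun polyrcf.
From mathcomp Require Import ring lra.
Import Order.TTheory GRing.Theory Num.Theory.
Import numFieldNormedType.Exports.
Local Open Scope classical_set_scope.
Local Open Scope ring_scope.

(** Divide the equation by b / 2 and put t = 2 / b. It becomes
      t x - t xi_N - sum_i t xi_i / (x - mu_i) = 0,
    where, by Chebyshev's inequality, each t xi_i (i < N) is close to 1 and
    t xi_N is close to a with probability tending to 1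
    (half_chi2_concentration, normal_tail). The rest is deterministic.

    At a fixed x other than the mu_i, the left-hand side tends to
    G x = - a - sum_i 1 / (x - mu_i), whose zeros are those of
    q = Pmu' + a Pmu (limit_equationP). As q alternates in sign along the mu_i
    and its sign at infinity is governed by a Pmu, it has one root in each gap
    and one outside (gap_root, outer_root); these exhaust its degree
    (limit_roots). Between poles G increases strictly, so it changes sign at
    each limiting root, and so does the perturbed function: this gives a
    solution near every limiting root (small_roots). At x of order 1 / t the
    pole terms are negligible and the equation reads t x = a approximately,
    which gives one more solution near a / t (big_root).

    These are N distinct solutions, listed in order, and there are exactly N
    ordered roots, so each lambda_j is identified with one of them
    (ordered_roots_unique, corner_roots). Hence, whenever the coefficients are
    close to their limits, all the claims hold with the required precision, and
    a union bound over the N coefficients concludes (ae_covered_cvg0).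

    Concentration of the Gamma law rests on the functional equation of Euler's
    integral (gamma_integralS), which gives its mean and variance. *)

Set Implicit Arguments.
Unset Strict Implicit.
Unset Printing Implicit Defensive.

(** * Concentration of the halved chi-squared law *)

Lemma measurable_dist_ge d (T : measurableType d) (R : realType) (f : T -> R)
    (c e : R) :
  measurable_fun setT f -> measurable [set w | e <= `|f w - c|].
Proof.
move=> mf; rewrite -[X in measurable X]setTI.
apply: (@measurable_fun_le _ _ R setT (cst e)) => //.
by apply: measurableT_comp => //; exact: measurable_funB.
Qed.

Section gamma.
Context {R : realType}.
Implicit Types s x y b e : R.
Local Notation leb := (@lebesgue_measure R).

Definition gamma_fun s x : R := x `^ (s - 1) * expR (- x).

Lemma gamma_fun_ge0 s x : 0 <= gamma_fun s x.
Proof. by rewrite mulr_ge0 ?powR_ge0 ?expR_ge0. Qed.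

Lemma measurable_gamma_fun s (D : set R) : measurable_fun D (gamma_fun s).
Proof.
apply: measurable_funTS; apply: measurable_funM; first exact: measurable_powR.
by apply: measurableT_comp => //.
Qed.

Lemma measurable_EFin_gamma_fun s (D : set R) :
  measurable_fun D (fun x => (gamma_fun s x)%:E).
Proof. by apply/measurable_EFinP; exact: measurable_gamma_fun. Qed.

Lemma measurable_sqr_gamma_fun s (D : set R) :
  measurable_fun D (fun x => ((x - s) ^+ 2 * gamma_fun s x)%:E).
Proof.
apply/measurable_EFinP; apply: measurable_funM; last exact: measurable_gamma_fun.
by apply: measurable_funX; exact: measurable_funB.
Qed.

Lemma gamma_funS s x : 0 < x -> gamma_fun (s + 1) x = x * gamma_fun s x.
Proof.
move=> x0; rewrite /gamma_fun mulrA; congr (_ * _).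
rewrite -[X in X * _](powRr1 (ltW x0)) -powRD;
  last by apply/implyP => _; rewrite gt_eqF.
by congr (_ `^ _); ring.
Qed.

Definition gamma_integral s : \bar R :=
  (\int[leb]_(x in `]0%R, +oo[) (gamma_fun s x)%:E)%E.

Lemma is_derive_gamma_funS s x : 0 < x ->
  is_derive x 1 (gamma_fun (s + 1)) ((s - x) * gamma_fun s x).
Proof.
move=> x0; rewrite /gamma_fun addrK.
have h := is_derive1_powR s x0.
have g : is_derive x 1 (fun y : R => expR (- y)) (- expR (- x)).
  by apply: is_derive_eq; rewrite mulrN1.
have -> : (fun y : R => y `^ s * expR (- y)) =
   (fun y => y `^ s) * (fun y => expR (- y)) by [].
apply: is_derive_eq.
rewrite -[x `^ s](_ : x * x `^ (s - 1) = _); last first.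
  rewrite -[X in X * _](powRr1 (ltW x0)) -powRD;
  last by apply/implyP => _; rewrite gt_eqF.
  by congr (_ `^ _); ring.
by rewrite /GRing.scale/=; ring.
Qed.

Lemma continuous_gamma_fun s x : 0 < x -> {for x, continuous (gamma_fun s)}.
Proof.
move=> x0; have := is_derive_gamma_funS (s - 1) x0; rewrite subrK => -[h _].
exact/differentiable_continuous/derivable1_diffP.
Qed.

Lemma gamma_fun_cvg0 s : 1 < s -> gamma_fun s x @[x --> 0^'+] --> gamma_fun s 0.
Proof.
move=> s1; rewrite /gamma_fun powR0 ?mul0r; last by rewrite gt_eqF// subr_gt0.
rewrite -[X in _ --> X](mul0r (expR (- 0))); apply: cvgM.
  by apply: powR_cvg0; rewrite subr_gt0.
apply: cvg_at_right_filter.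
by apply: (@cvg_comp _ _ _ -%R expR);
  [apply: cvgN; exact: cvg_id|exact: continuous_expR].
Qed.

(** Since ln y < y at y = x / 2s, the power x^s is at most a constant times
    e^(x/2), so half of the exponential decay is left over. *)
Lemma gamma_fun_cvgy s : 0 < s -> gamma_fun (s + 1) x @[x --> +oo] --> (0 : R).
Proof.
move=> s0; pose C : R := expR (s * ln (2 * s)).
have le x : 0 < x -> gamma_fun (s + 1) x <= C * expR (- (x / 2)).
  move=> x0; rewrite /gamma_fun addrK /C /powR gt_eqF// -!expRD ler_expR.
  have x2 : 0 < x / (2 * s) by rewrite divr_gt0// mulr_gt0.
  have h := ltW (ln_sublinear x2).
  have -> : ln x = ln (x / (2 * s)) + ln (2 * s).
    have s2 : 0 < 2 * s by rewrite mulr_gt0.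
    by rewrite -lnM// divfK// gt_eqF.
  have : s * ln (x / (2 * s)) <= s * (x / (2 * s)) by rewrite ler_pM2l.
  have -> : s * (x / (2 * s)) = x / 2 by field; rewrite gt_eqF.
  lra.
apply: (@squeeze_cvgr _ _ _ _ (fun=> 0) (fun x => C * expR (- (x / 2)))).
- by near=> x; rewrite gamma_fun_ge0 le.
- exact: cvg_cst.
- rewrite -(mulr0 C); apply: cvgMr.
  apply: (@cvg_comp _ _ _ (fun x : R => x / 2) (fun x => expR (- x)) _ +oo).
    by apply: gt0_cvgMly.
  exact: cvgr_expR.
Unshelve. all: by end_near. Qed.

Local Open Scope ereal_scope.

(** The functional equation of Euler's integral. The derivative of x^s e^-x is
    (s - x) x^(s-1) e^-x, which changes sign only at s; applying the fundamental
    theorem of calculus on ]0, s] and on ]s, +oo[ separately keeps every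
    integrand nonnegative. The boundary terms s^s e^-s of the two halves cancel,
    so that the equation holds in the extended reals without knowing that the
    integrals are finite. *)
Lemma gamma_integralS s : (1 < s)%R ->
  gamma_integral (s + 1) = s%:E * gamma_integral s.
Proof.
move=> s1; have s0 : (0 < s)%R by lra.
have split_s t : gamma_integral t = \int[leb]_(x in `]0%R, s]) (gamma_fun t x)%:E +
    \int[leb]_(x in `]s, +oo[) (gamma_fun t x)%:E.
  rewrite /gamma_integral -ge0_integral_setU//=.
  - congr (integral _ _ _); rewrite -itv_bndbnd_setU// bnd_simp; lra.
  - by apply/measurable_EFinP; exact: measurable_gamma_fun.
  - by move=> x _; rewrite lee_fin gamma_fun_ge0.
  - apply: lt_disjoint => x y; rewrite !in_itv/= => /andP[_ xs] /andP[sy _].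
    exact: le_lt_trans xs sy.
have mD t (D : set R) : measurable_fun D (fun x => ((s - x) * gamma_fun t x)%:E).
  apply/measurable_EFinP; apply: measurable_funM; last exact: measurable_gamma_fun.
  exact: measurable_funB.
have mN t (D : set R) : measurable_fun D (fun x => ((x - s) * gamma_fun t x)%:E).
  apply/measurable_EFinP; apply: measurable_funM; last exact: measurable_gamma_fun.
  exact: measurable_funB.
have left_part : s%:E * \int[leb]_(x in `]0%R, s]) (gamma_fun s x)%:E =
    \int[leb]_(x in `]0%R, s]) (gamma_fun (s + 1) x)%:E + (gamma_fun (s + 1) s)%:E.
  have -> : (gamma_fun (s + 1) s)%:E =
      \int[leb]_(x in `]0%R, s]) ((s - x) * gamma_fun s x)%:E.
    rewrite integral_itv_obnd_cbnd//.
    rewrite (@continuous_FTC2 _ _ (gamma_fun (s + 1)))//.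
    - by rewrite -EFinB /gamma_fun addrK powR0 ?gt_eqF// mul0r subr0.
    - apply/continuous_within_itvP => //; split.
      + move=> x; rewrite in_itv/= => /andP[x0 _].
        apply: cvgM; first by apply: cvgB; [exact: cvg_cst|exact: cvg_id].
        exact: continuous_gamma_fun.
      + apply: cvgM; last exact: gamma_fun_cvg0.
        by apply: cvgB; [exact: cvg_cst|exact: cvg_at_right_filter].
      + apply: cvgM; last by apply: cvg_at_left_filter; exact: continuous_gamma_fun.
        by apply: cvgB; [exact: cvg_cst|exact: cvg_at_left_filter].
    - split.
      + by move=> x; rewrite in_itv/= => /andP[x0 _]; case: (is_derive_gamma_funS s x0).
      + by apply: gamma_fun_cvg0; lra.
      + by apply: cvg_at_left_filter; exact: continuous_gamma_fun.
    - move=> x; rewrite in_itv/= => /andP[x0 _].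
      by rewrite derive1E; case: (is_derive_gamma_funS s x0).
  rewrite -ge0_integralD//=; first last.
  - exact: mD.
  - move=> x; rewrite in_itv/= => /andP[_ xs].
    by rewrite lee_fin mulr_ge0 ?gamma_fun_ge0// subr_ge0.
  - exact: measurable_EFin_gamma_fun.
  - by move=> x _; rewrite lee_fin gamma_fun_ge0.
  rewrite -ge0_integralZl//=; first last.
  - by rewrite lee_fin ltW.
  - by move=> x _; rewrite lee_fin gamma_fun_ge0.
  - exact: measurable_EFin_gamma_fun.
  apply: eq_integral => x; rewrite inE/= in_itv/= => /andP[x0 xs].
  by rewrite gamma_funS// -EFinM -EFinD; congr _%:E; ring.
have right_part : \int[leb]_(x in `]s, +oo[) (gamma_fun (s + 1) x)%:E =
    s%:E * \int[leb]_(x in `]s, +oo[) (gamma_fun s x)%:E + (gamma_fun (s + 1) s)%:E.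
  have -> : (gamma_fun (s + 1) s)%:E =
      \int[leb]_(x in `]s, +oo[) ((x - s) * gamma_fun s x)%:E.
    rewrite integral_itv_obnd_cbnd//.
    rewrite (@ge0_continuous_FTC2y _ _ (fun x => - gamma_fun (s + 1) x)%R _ 0%R)//.
    - by rewrite -EFinB opprK add0r.
    - by move=> x sx; rewrite mulr_ge0 ?gamma_fun_ge0// subr_ge0.
    - apply/continuous_within_itvcyP; split.
      + move=> x; rewrite in_itv/= => /andP[sx _].
        apply: cvgM; first by apply: cvgB; [exact: cvg_id|exact: cvg_cst].
        by apply: continuous_gamma_fun; lra.
      + apply: cvgM; last by apply: cvg_at_right_filter; exact: continuous_gamma_fun.
        by apply: cvgB; [exact: cvg_at_right_filter|exact: cvg_cst].
    - by rewrite -oppr0; apply: cvgN; exact: gamma_fun_cvgy.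
    - move=> x sx; apply: derivableN; have x0 : (0 < x)%R by lra.
      by case: (is_derive_gamma_funS s x0).
    - by apply: cvgN; apply: cvg_at_right_filter; exact: continuous_gamma_fun.
    - move=> x; rewrite in_itv/= andbT => sx; have x0 : (0 < x)%R by lra.
      have [d1 d2] := is_derive_gamma_funS s x0.
      by rewrite derive1E deriveN// d2; ring.
  rewrite -ge0_integralZl//=; first last.
  - by rewrite lee_fin ltW.
  - by move=> x _; rewrite lee_fin gamma_fun_ge0.
  - exact: measurable_EFin_gamma_fun.
  rewrite -ge0_integralD//=; first last.
  - exact: mN.
  - move=> x; rewrite in_itv/= => /andP[sx _].
    by rewrite lee_fin mulr_ge0 ?gamma_fun_ge0// subr_ge0 ltW.
  - by apply: measurable_funeM; exact: measurable_EFin_gamma_fun.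
  - by move=> x _; rewrite -EFinM lee_fin mulr_ge0 ?gamma_fun_ge0// ltW.
  apply: eq_integral => x; rewrite inE/= in_itv/= => /andP[sx _].
  by rewrite gamma_funS; [rewrite -EFinM -EFinD; congr _%:E; ring|lra].
have ge0 D : 0 <= \int[leb]_(x in D) (gamma_fun s x)%:E.
  by apply: integral_ge0 => x _; rewrite lee_fin gamma_fun_ge0.
rewrite !split_s right_part.
move: (ge0 `]0%R, s]%classic) (ge0 `]s, +oo[%classic) left_part.
move: (integral _ _ _) (integral _ _ _) (integral _ _ _) => A A' B A0 B0 AB.
by rewrite ge0_muleDr// AB addeA addeAC.
Qed.

(** The Gamma law of shape s has variance s: integrate the identity
    x^2 + s^2 = (x - s)^2 + 2 s x, written without subtraction of integrals, and
    use the functional equation for the first and second moments. *)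
Lemma gamma_integral_variance s : (1 < s)%R ->
    gamma_integral s \is a fin_num ->
  \int[leb]_(x in `]0%R, +oo[) ((x - s) ^+ 2 * gamma_fun s x)%:E =
  s%:E * gamma_integral s.
Proof.
move=> s1 finG; have s0 : (0 < s)%R by lra.
have p1 t (x : R) : 0 <= (gamma_fun t x)%:E by rewrite lee_fin gamma_fun_ge0.
have p2 c t (x : R) : (0 <= c)%R -> 0 <= c%:E * (gamma_fun t x)%:E.
  by move=> c0; rewrite mule_ge0// lee_fin.
have p3 (x : R) : 0 <= ((x - s) ^+ 2 * gamma_fun s x)%:E.
  by rewrite lee_fin mulr_ge0 ?gamma_fun_ge0// sqr_ge0.
have s_ge0 : (0 <= 2 * s)%R by rewrite mulr_ge0// ltW.
set V := LHS.
have key : gamma_integral (s + 1 + 1) + (s ^+ 2)%:E * gamma_integral s =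
    V + (2 * s)%:E * gamma_integral (s + 1).
  rewrite /gamma_integral /V -!ge0_integralZl//=;
    do ?[exact: measurable_EFin_gamma_fun|by move=> x _; exact: p1|
         by rewrite lee_fin sqr_ge0].
  rewrite -!ge0_integralD//=;
    do ?[exact: measurable_EFin_gamma_fun|exact: measurable_sqr_gamma_fun|
         by apply: measurable_funeM; exact: measurable_EFin_gamma_fun|
         by move=> x _; exact: p1|by move=> x _; exact: p3|
         by move=> x _; apply: p2; rewrite ?sqr_ge0].
  apply: eq_integral => x; rewrite inE/= in_itv/= andbT => x0.
  rewrite !gamma_funS// -!EFinM -!EFinD; congr _%:E; ring.
have s2 : (1 < s + 1)%R by lra.
rewrite (gamma_integralS s2) (gamma_integralS s1) in key.
move: key; rewrite -(fineK finG) -!EFinM -!EFinD.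
by case: V => [v| |] //= [h]; congr _%:E; lra.
Qed.

Lemma half_chi2_prob_gamma b : half_chi2_prob b setT =
  ((Gamma (b / 2))^-1)%:E * gamma_integral (b / 2).
Proof.
rewrite /half_chi2_prob setTI /half_chi2_pdf /gamma_integral.
rewrite -ge0_integralZl//=;
  do ?[exact: measurable_EFin_gamma_fun|by move=> x _; rewrite lee_fin gamma_fun_ge0].
  by apply: eq_integral => x _; rewrite -EFinM /gamma_fun mulrA.
rewrite lee_fin invr_ge0 fine_ge0//.
by apply: integral_ge0 => x _; rewrite lee_fin gamma_fun_ge0.
Qed.

(** An infinite Euler integral would have real part 0 and inverse 0, making the
    total mass 0. Being a probability law thus already yields finiteness. *)
Lemma half_chi2_fin_num b : half_chi2_prob b setT = 1 ->
  gamma_integral (b / 2) \is a fin_num /\ (0 < Gamma (b / 2))%R.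
Proof.
rewrite half_chi2_prob_gamma.
have -> : Gamma (b / 2) = fine (gamma_integral (b / 2)) by [].
have : 0 <= gamma_integral (b / 2).
  by apply: integral_ge0 => x _; rewrite lee_fin gamma_fun_ge0.
case: (gamma_integral (b / 2)) => [r| |] // r0 /=.
  move: r0; rewrite lee_fin le_eqVlt => /predU1P[<-|//].
  by rewrite mule0 => /eqP; rewrite eqe eq_sym oner_eq0.
by rewrite invr0 mul0e => /eqP; rewrite eqe eq_sym oner_eq0.
Qed.

(** Chebyshev's inequality for a law of mean b / 2 and variance b / 2. *)
Lemma half_chi2_concentration b e : (2 < b)%R -> (0 < e)%R ->
    half_chi2_prob b setT = 1 ->
  half_chi2_prob b [set x | (e <= `|2 / b * x - 1|)%R] <= (2 / b / e ^+ 2)%:E.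
Proof.
move=> b2 e0 tot; have [fin G0] := half_chi2_fin_num tot.
set s := (b / 2)%R in fin G0.
have s1 : (1 < s)%R by rewrite /s; lra.
have bs : (b = 2 * s)%R by rewrite /s; lra.
set A := [set x | _].
have mA : measurable A by apply: measurable_dist_ge; exact: measurable_funM.
pose c : R := ((s * e) ^- 2 / Gamma s)%R.
have c0 : (0 <= c)%R by rewrite divr_ge0 ?(ltW G0)// invr_ge0 sqr_ge0.
apply: (@le_trans _ _ (c%:E *
    (\int[leb]_(x in `]0%R, +oo[) ((x - s) ^+ 2 * gamma_fun s x)%:E))).
  rewrite -ge0_integralZl//=;
    do ?[exact: measurable_sqr_gamma_fun|
         by move=> x _; rewrite lee_fin mulr_ge0 ?gamma_fun_ge0 ?sqr_ge0].
  apply: (@le_trans _ _ (\int[leb]_(x in A `&` `]0%R, +oo[)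
      (c%:E * ((x - s) ^+ 2 * gamma_fun s x)%:E))).
    rewrite /half_chi2_prob; apply: ge0_le_integral => //.
    - exact: measurableI.
    - move=> x _; rewrite lee_fin /half_chi2_pdf -mulrA; apply: mulr_ge0.
        by rewrite invr_ge0 ltW.
      by rewrite mulr_ge0 ?powR_ge0 ?expR_ge0.
    - apply/measurable_EFinP.
      have -> : half_chi2_pdf b = (fun x => (Gamma s)^-1 * gamma_fun s x)%R.
        by apply/funext => x; rewrite /half_chi2_pdf -mulrA.
      by apply: measurable_funM => //; exact: measurable_gamma_fun.
    - by apply: measurable_funeM; exact: measurable_sqr_gamma_fun.
    (* on A the factor ((x - s) / (s e))^2 is at least 1 *)
    - move=> x [Ax _]; rewrite -EFinM lee_fin /half_chi2_pdf -/s -mulrA.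
      rewrite -/(gamma_fun s x) /c [leRHS]mulrA ler_wpM2r ?gamma_fun_ge0// mulrAC.
      rewrite ler_peMl ?invr_ge0 ?(ltW G0)//.
      rewrite mulrC ler_pdivlMr ?mul1r; last by rewrite exprn_gt0// mulr_gt0//; lra.
      have -> : (x - s = s * (2 / b * x - 1))%R.
        by rewrite bs; field; rewrite gt_eqF//; lra.
      rewrite [((s * e) ^+ 2)%R]exprMn [((s * _) ^+ 2)%R]exprMn ler_pM2l;
        last by rewrite exprn_gt0//; lra.
      by rewrite -[leRHS]real_normK ?num_real// ler_pXn2r ?nnegrE// ltW.
  apply: ge0_subset_integral => //.
  - exact: measurableI.
  - by apply: measurable_funeM; exact: measurable_sqr_gamma_fun.
  - by move=> x _; rewrite -EFinM lee_fin mulr_ge0// mulr_ge0 ?gamma_fun_ge0// sqr_ge0.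
rewrite gamma_integral_variance// /c.
have -> : Gamma s = fine (gamma_integral s) by [].
move: G0; have -> : Gamma s = fine (gamma_integral s) by [].
rewrite -{3}(fineK fin) -!EFinM lee_fin bs.
move: (fine _) => g g0; rewrite le_eqVlt; apply/orP; left; apply/eqP.
by field; rewrite !gt_eqF//; lra.
Qed.
End gamma.

(** * A tail bound for the normal law *)

Section normal_tail.
Context {R : realType}.
Implicit Types m K x : R.

(** The density of variance 1 is, up to a constant, the density of variance 2
    multiplied by exp(- (x - m)^2 / 4); on the tail this factor is at most
    4 / K^2, and the density of variance 2 has total mass 1. The constant does
    not depend on m, which is what a mean growing with b requires. *)
Lemma normal_tail : exists2 C : R, 0 <= C & forall m K, 0 < K ->
  (normal_prob m 1 [set x : R | (K <= `|x - m|)%R] <= (C / K ^+ 2)%:E)%E.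
Proof.
pose q : R := Num.sqrt 2.
have q0 : q != 0 by rewrite gt_eqF// sqrtr_gt0.
have p1 : 0 < normal_peak (1 : R) by rewrite normal_peak_gt0// oner_neq0.
have pq : 0 < normal_peak q by rewrite normal_peak_gt0.
exists (4 * (normal_peak 1 / normal_peak q)).
  by rewrite mulr_ge0// divr_ge0// ltW.
move=> m K K0; set A := [set x | _].
have mA : measurable A by exact: measurable_dist_ge.
set c : R := _ / K ^+ 2.
have c0 : 0 <= c by rewrite divr_ge0 ?sqr_ge0// mulr_ge0// divr_ge0// ltW.
have mq s (D : set R) : measurable_fun D (fun x => (normal_pdf m s x)%:E).
  by apply/measurable_EFinP; apply: measurable_funTS; exact: measurable_normal_pdf.
rewrite -[leRHS]mule1 -(integral_normal_pdf m q) -ge0_integralZl//=;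
  do ?[exact: mq|by move=> x _; rewrite lee_fin normal_pdf_ge0].
apply: (@le_trans _ _
    (\int[lebesgue_measure]_(x in A) (c%:E * (normal_pdf m q x)%:E))%E).
  apply: ge0_le_integral => //.
  - by move=> x _; rewrite lee_fin normal_pdf_ge0.
  - exact: mq.
  - by apply: measurable_funeM; exact: mq.
  move=> x Ax; rewrite -EFinM lee_fin !normal_pdfE ?oner_neq0//.
  have DK : K ^+ 2 <= (x - m) ^+ 2.
    by rewrite -[leRHS]real_normK ?num_real// ler_pXn2r ?nnegrE// ltW.
  pose E := expR (- ((x - m) ^+ 2 / 4)).
  have fq : normal_fun m q x = E.
    by rewrite /normal_fun sqr_sqrtr// /E; congr expR; rewrite -mulr_natr; field.
  have f1 : normal_fun m 1 x = E * E.
    by rewrite /normal_fun /E -expRD expr1n; congr expR; field.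
  have E4 : E <= 4 / K ^+ 2.
    rewrite /E expRN -[leRHS]invf_div lef_pV2 ?posrE ?expR_gt0 ?divr_gt0 ?exprn_gt0//.
    have := expR_ge1Dx ((x - m) ^+ 2 / 4); lra.
  rewrite fq f1.
  have -> : c * (normal_peak q * E) = normal_peak 1 * (4 / K ^+ 2 * E).
    by rewrite /c; field; rewrite !gt_eqF.
  by rewrite ler_pM2l// ler_pM2r// expR_gt0.
apply: ge0_subset_integral => //.
- by apply: measurable_funeM; exact: mq.
- by move=> x _; rewrite -EFinM lee_fin mulr_ge0// normal_pdf_ge0.
Qed.
End normal_tail.

(** * Sums of simple poles *)

Section pole_sum.
Context {R : realType} {m : nat}.
Implicit Types (c mu : 'I_m -> R) (x u v : R).

Definition pole_sum c mu x : R := \sum_(i < m) c i / (x - mu i).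

(** For u < v: no mu i lies in [u, v], as u and v are on the same side of each. *)
Definition pole_free mu u v := forall i, 0 < (u - mu i) * (v - mu i).

Lemma pole_freeP mu u v x : pole_free mu u v -> u <= x <= v ->
  forall i, x != mu i.
Proof.
move=> uv /andP[ux xv] i; apply/eqP => xi; have := uv i.
by rewrite -xi ltNge mulr_le0_ge0// ?subr_le0 ?subr_ge0.
Qed.

Lemma pole_sum_decr mu u v : (0 < m)%N -> pole_free mu u v -> u < v ->
  pole_sum (fun=> 1) mu v < pole_sum (fun=> 1) mu u.
Proof.
move=> m0 uv ltuv; apply: ltr_sum => [|i _].
  by apply/hasP; exists (Ordinal m0); rewrite ?mem_index_enum.
have u0 : u - mu i != 0 by apply/eqP => h; have := uv i; rewrite h mul0r ltxx.
have v0 : v - mu i != 0 by apply/eqP => h; have := uv i; rewrite h mulr0 ltxx.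
rewrite -subr_gt0.
have -> : 1 / (u - mu i) - 1 / (v - mu i) = (v - u) / ((u - mu i) * (v - mu i)).
  by field; rewrite u0 v0.
by rewrite divr_gt0 ?subr_gt0//; exact: uv.
Qed.

Lemma continuous_pole_sum c mu x : (forall i, x != mu i) ->
  {for x, continuous (pole_sum c mu)}.
Proof.
move=> xmu; rewrite /pole_sum.
apply: (cvg_big (op := +%R)) => [|i _]; first exact: add_continuous.
apply: cvgM; first exact: cvg_cst.
apply: cvgV; first by rewrite subr_eq0.
by apply: cvgB; [exact: cvg_id|exact: cvg_cst].
Qed.

Lemma pole_free_ivt c mu t z u v (F := fun x => t * x - z - pole_sum c mu x) :
  pole_free mu u v -> u < v -> F u < 0 -> 0 < F v ->
  exists x, [/\ u < x < v, forall i, x != mu i & F x = 0].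
Proof.
move=> uv ltuv Fu Fv.
have cF : {within `[u, v], continuous F}.
  apply: continuous_in_subspaceT => x; rewrite inE/= in_itv/= => uxv.
  apply: cvgB; last by apply: continuous_pole_sum; exact: pole_freeP uxv.
  by apply: cvgB; [apply: cvgMr; exact: cvg_id|exact: cvg_cst].
have [|x] := @IVT _ F u v 0 (ltW ltuv) cF.
  have FF := ltW (lt_trans Fu Fv).
  by rewrite min_l ?max_r ?(ltW Fu) ?(ltW Fv).
rewrite in_itv/= => /andP[ux xv] Fx.
exists x; split=> //; last by apply: (pole_freeP uv); rewrite ux.
rewrite !lt_neqAle ux xv !andbT; apply/andP; split; apply/eqP => h.
  by move: Fu; rewrite h Fx ltxx.
by move: Fv; rewrite -h Fx ltxx.
Qed.

Lemma horner_Pmu mu x : (Pmu mu).[x] = \prod_(i < m) (x - mu i).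
Proof. by rewrite horner_prod; under eq_bigr do rewrite hornerXsubC. Qed.

(** The logarithmic derivative of Pmu. *)
Lemma horner_deriv_Pmu mu x : (forall i, x != mu i) ->
  ((Pmu mu)^`()).[x] = (Pmu mu).[x] * pole_sum (fun=> 1) mu x.
Proof.
move=> xmu; rewrite /Pmu /pole_sum.
elim: (index_enum _) => [|i r IH]; first by rewrite !big_nil derivC horner0 mulr0.
rewrite !big_cons derivM !hornerE/= IH derivXsubC !hornerE/=.
by field; rewrite subr_eq0.
Qed.

Lemma horner_deriv_Pmu_pole mu j :
  ((Pmu mu)^`()).[mu j] = \prod_(i < m | i != j) (mu j - mu i).
Proof.
rewrite /Pmu (bigD1 j)//= derivM !hornerE/= subrr mul0r addr0 derivXsubC hornerC mul1r.
by rewrite horner_prod; under eq_bigr do rewrite hornerXsubC.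
Qed.
End pole_sum.

(** * The limiting roots *)

Section limit_roots.
Context {R : realType} {n : nat} (a : R) (mu : 'I_n.+1 -> R).
Hypothesis a_neq0 : a != 0.
Hypothesis mu_decr : forall i j : 'I_n.+1, (i < j)%N -> mu j < mu i.

Let q := (Pmu mu)^`() + a *: Pmu mu.

Lemma mu_nonincr (i j : 'I_n.+1) : (i <= j)%N -> mu j <= mu i.
Proof.
rewrite leq_eqVlt => /predU1P[ij|/mu_decr/ltW//].
by rewrite (ord_inj ij).
Qed.

Lemma mu_inj (i j : 'I_n.+1) : i != j -> mu i != mu j.
Proof.
by move=> ij; case: (ltngtP i j) => [/mu_decr/gt_eqF->|/mu_decr/lt_eqF->|/ord_inj/eqP];
  rewrite ?(negbTE ij).
Qed.

Lemma horner_limit_poly x : (forall i, x != mu i) ->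
  q.[x] = (Pmu mu).[x] * (pole_sum (fun=> 1) mu x + a).
Proof. by move=> xmu; rewrite hornerD hornerZ horner_deriv_Pmu//; ring. Qed.

Lemma horner_limit_poly_pole j : q.[mu j] = \prod_(i < n.+1 | i != j) (mu j - mu i).
Proof.
rewrite hornerD hornerZ horner_deriv_Pmu_pole horner_Pmu.
by rewrite [X in a * X](bigD1 j)//= subrr mul0r mulr0 addr0.
Qed.

Lemma limit_poly_pole_neq0 j : q.[mu j] != 0.
Proof.
rewrite horner_limit_poly_pole; apply/prodf_neq0 => i ij.
by rewrite subr_eq0 mu_inj// eq_sym.
Qed.

Lemma limit_equationP x : limit_equation mu a x <-> root q x.
Proof.
split=> [[xmu]|].
  move=> h; rewrite /root horner_limit_poly//.
  by rewrite -/(pole_sum (fun=> 1) mu x) in h; rewrite h addNr mulr0.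
rewrite /root => qx.
have xmu i : x != mu i.
  by apply/eqP => xi; move: qx; rewrite xi (negbTE (limit_poly_pole_neq0 i)).
split=> //; move: qx; rewrite horner_limit_poly// mulf_eq0 horner_Pmu => /orP[|].
  by move=> /prodf_eq0[i _]; rewrite subr_eq0 (negbTE (xmu i)).
by rewrite addr_eq0 => /eqP.
Qed.

(** At a pole mu_j the polynomial takes the value prod_(i != j) (mu_j - mu_i).
    For two neighbouring poles these values have opposite signs: every other
    index contributes two factors of the same sign, and the two factors that
    compare the neighbours are opposite to each other. *)
Lemma gap_root (i : 'I_n) : exists2 x,
  limit_equation mu a x & mu (lift ord0 i) < x < mu (widen_ord (leqnSn n) i).
Proof.
set u := lift ord0 i; set v := widen_ord _ i.
have vu : (v < u)%N by [].
have uv : u != v by rewrite -(inj_eq val_inj) gtn_eqF.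
have [|x] := @poly_ivtoo _ q (mu u) (mu v) (ltW (mu_decr vu)).
  rewrite !horner_limit_poly_pole (bigD1 v) 1?eq_sym//= [X in _ * X](bigD1 u)//=.
  rewrite mulrACA; under [X in _ * (_ * X)]eq_bigl do rewrite andbC.
  rewrite -big_split/= nmulr_rlt0.
    apply: prodr_gt0 => j /andP[ju jv].
    case: (ltngtP j v) => [jv'|jv'|/ord_inj/eqP]; last by rewrite (negbTE jv).
      have ju' := ltn_trans jv' vu.
      by rewrite -mulrNN !opprB mulr_gt0// subr_gt0 mu_decr.
    have ju' : (u < j)%N.
      rewrite ltn_neqAle jv' andbT; apply/eqP => h.
      by move: ju; rewrite (ord_inj h) eqxx.
    by rewrite mulr_gt0// subr_gt0 mu_decr.
  by rewrite -opprB mulNr oppr_lt0 -expr2 exprn_gt0// subr_gt0 mu_decr.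
by rewrite in_itv/= => uxv qx; exists x => //; exact/limit_equationP.
Qed.

(** The extreme pole k0 on the side opposite to the sign of a is compared with
    the point u at distance C = (n + 2) / |a| beyond it. There the sum of n + 1
    poles is smaller than |a|, so that pole_sum + a has the sign of a, whereas
    the sign of Pmu u relative to the value at the pole comes from the single
    factor u - mu_k0. *)
Lemma outer_root : exists2 x,
  limit_equation mu a x & if 0 < a then x < mu ord_max else mu ord0 < x.
Proof.
pose C := n.+2%:R / `|a|.
have a0 : 0 < `|a| by rewrite normr_gt0.
have C0 : 0 < C by rewrite divr_gt0.
pose k0 : 'I_n.+1 := if 0 < a then ord_max else ord0.
pose u := mu k0 - Num.sg a * C.
have side i : 0 <= Num.sg a * (mu i - mu k0).
  rewrite /k0; case: (ltgtP a 0) a_neq0 => // a0' _.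
    by rewrite ltr0_sg// mulN1r opprB subr_ge0 mu_nonincr.
  by rewrite gtr0_sg// mul1r subr_ge0 mu_nonincr// -ltnS.
have far i : C <= Num.sg a * (mu i - u).
  have -> : Num.sg a * (mu i - u) = Num.sg a * (mu i - mu k0) + Num.sg a ^+ 2 * C.
    by rewrite /u; ring.
  by rewrite sqr_sg a_neq0 mul1r lerDr.
have umu i : u != mu i.
  by apply/eqP => h; have := far i; rewrite -h subrr mulr0 leNgt C0.
have hu : `|pole_sum (fun=> 1) mu u| < `|a|.
  apply: le_lt_trans (ler_norm_sum _ _ _) _.
  apply: (@le_lt_trans _ _ (\sum_(i < n.+1) C^-1)).
    apply: ler_sum => i _; rewrite mul1r normrV ?unitfE ?subr_eq0//.
    rewrite lef_pV2 ?posrE ?normr_gt0 ?subr_eq0//.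
    apply: le_trans (far i) (le_trans (ler_norm _) _).
    by rewrite normrM normr_sg a_neq0 mul1r distrC.
  rewrite sumr_const card_ord -[ltLHS]mulr_natr /C invf_div mulrAC.
  by rewrite ltr_pdivrMr// ltr_pM2l// ltr_nat.
have ah : 0 < Num.sg a * (pole_sum (fun=> 1) mu u + a).
  move: hu; rewrite mulrDr -normrEsg ltr_norml => /andP[h1 h2].
  case: (ltgtP a 0) a_neq0 h1 h2 => // a0' _.
    by rewrite ltr0_sg// ltr0_norm//; lra.
  by rewrite gtr0_sg// gtr0_norm//; lra.
have qq : q.[u] * q.[mu k0] < 0.
  rewrite horner_limit_poly// horner_limit_poly_pole horner_Pmu (bigD1 k0)//=.
  set A := \prod_(i | _) (u - mu i); set B := \prod_(i | _) _.
  have AB : 0 < A * B.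
    rewrite /A /B -big_split/=; apply: prodr_gt0 => i ik.
    have -> : (u - mu i) * (mu k0 - mu i) =
        (Num.sg a * (mu i - u)) * (Num.sg a * (mu i - mu k0)).
      by rewrite mulrACA -expr2 sqr_sg a_neq0 mul1r; ring.
    apply: mulr_gt0; first exact: lt_le_trans C0 (far i).
    rewrite lt_neqAle side andbT eq_sym.
    by rewrite mulf_neq0 ?sgr_eq0// subr_eq0 mu_inj.
  set h := (_ + a) in ah *.
  have -> : (u - mu k0) * A * h * B = - (C * (Num.sg a * h) * (A * B)).
    by rewrite /u; ring.
  by rewrite oppr_lt0; apply: mulr_gt0 => //; apply: mulr_gt0.
move: qq; rewrite /u /k0; case: (ltgtP a 0) a_neq0 => // a0' _ qq.
  rewrite ltr0_sg// mulN1r opprK in qq.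
  have [||x] := @poly_ivtoo _ q (mu ord0) (mu ord0 + C);
    rewrite ?lerDl ?ltW// 1?mulrC//.
  by rewrite in_itv/= => /andP[ux _] qx; exists x => //; exact/limit_equationP.
rewrite gtr0_sg// mul1r in qq.
have [||x] := @poly_ivtoo _ q (mu ord_max - C) (mu ord_max); rewrite ?gerBl ?ltW//.
by rewrite in_itv/= => /andP[_ xv] qx; exists x => //; exact/limit_equationP.
Qed.

(** One root per gap and one outer root make n + 1 distinct roots of a polynomial
    of degree n + 1, so that there are no others. Inserting the outer root at
    index k0, the last or the first one according to the sign of a, lists them
    in decreasing order. *)
Lemma limit_roots : exists r : 'I_n.+1 -> R,
  [/\ forall i j : 'I_n.+1, (i < j)%N -> r j < r i,
      ordered_roots (limit_equation mu a) r,
      forall i : 'I_n, exists! k : 'I_n.+1,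
        mu (lift ord0 i) < r k < mu (widen_ord (leqnSn n) i) &
      exists! k : 'I_n.+1,
        if 0 < a then r k < mu ord_max else mu ord0 < r k].
Proof.
have /choice[g gP] : forall i : 'I_n, exists x, limit_equation mu a x /\
    mu (lift ord0 i) < x < mu (widen_ord (leqnSn n) i).
  by move=> i; have [x] := gap_root i; exists x.
have [out outP out_side] := outer_root.
pose k0 : 'I_n.+1 := if 0 < a then ord_max else ord0.
pose r k := if unlift k0 k is Some i then g i else out.
have rk0 : r k0 = out by rewrite /r unlift_none.
have rlift i : r (lift k0 i) = g i by rewrite /r liftK.
have g_lt i : g i < mu ord0.
  have [_ /andP[_ h]] := gP i; apply: lt_le_trans h _; exact: mu_nonincr.
have g_gt i : mu ord_max < g i.
  have [_ /andP[h _]] := gP i; apply: le_lt_trans h; apply: mu_nonincr.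
  exact: leq_ord.
have g_decr (i j : 'I_n) : (i < j)%N -> g j < g i.
  move=> ij; have [_ /andP[hi _]] := gP i; have [_ /andP[_ hj]] := gP j.
  by apply: lt_trans hj (le_lt_trans _ hi); exact: mu_nonincr.
have r_eq k : limit_equation mu a (r k).
  by rewrite /r; case: unliftP => // i _; case: (gP i).
have r_decr (i j : 'I_n.+1) : (i < j)%N -> r j < r i.
  case: (unliftP k0 i) => [i'|] ->; case: (unliftP k0 j) => [j'|] ->;
    rewrite ?rlift ?rk0 ?ltnn//.
  - rewrite /lift/= => ij; apply: g_decr; move: ij; rewrite ltnNge leq_bump2 -ltnNge//.
  - move: out_side; rewrite /k0; case: ifP => // _ h _; exact: lt_trans h (g_gt _).
  - move: out_side; rewrite /k0; case: ifP => // _ h ij;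
      last exact: lt_trans (g_lt _) h.
    move: ij; rewrite lift_max/= ltnNge ltnW//.
exists r; split => //.
- split=> [i j|x]; first by rewrite leq_eqVlt => /predU1P[/ord_inj->|/r_decr/ltW].
  split=> [xE|[j ->]//].
  apply: contrapT => xr.
  have q_neq0 : q != 0.
    by apply: contra (limit_poly_pole_neq0 ord0) => /eqP ->; rewrite horner0.
  have size_q : (size q <= n.+2)%N.
    have size_P : size (Pmu mu) = n.+2.
      by rewrite /Pmu -big_enum size_prod_XsubC size_enum_ord.
    rewrite (leq_trans (size_polyD _ _))// geq_max.
    rewrite (leq_trans (size_scale_leq _ _)) ?size_P// andbT -size_P.
    by rewrite ltnW// lt_size_deriv// -size_poly_eq0 size_P.
  have r_inj : injective r.
    move=> i j rij; case: (ltngtP i j) => [/r_decr|/r_decr|/ord_inj//];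
      by rewrite rij ltxx.
  have := @max_poly_roots _ q (x :: codom r) q_neq0.
  rewrite /= size_codom card_ord ltnNge size_q => H; apply: notF; apply: H.
    apply/andP; split; first exact/limit_equationP.
    by apply/allP => _ /codomP[k ->]; exact/limit_equationP.
  rewrite map_inj_uniq ?enum_uniq// andbT.
  by apply/negP => /codomP[k xk]; apply: xr; exists k.
- move=> i; exists (lift k0 i); split; first by rewrite rlift; case: (gP i).
  move=> k; case: (unliftP k0 k) => [j|] ->; rewrite ?rlift ?rk0.
    move=> /andP[h1 h2]; congr lift; have [_ /andP[h3 h4]] := gP j.
    case: (ltngtP i j) => [ij|ji|/ord_inj//].
      have := lt_trans h1 h4; rewrite ltNge mu_nonincr//.
    have := lt_trans h3 h2; rewrite ltNge mu_nonincr//.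
  move: out_side; case: ifP => _ h /andP[h1 h2].
    have := lt_trans h1 h; rewrite ltNge mu_nonincr//; exact: leq_ord.
  have := lt_trans h h2; rewrite ltNge mu_nonincr//.
- exists k0; split; first by rewrite rk0.
  move=> k; case: (unliftP k0 k) => [j|] -> //; rewrite rlift.
  case: ifP => _ h.
    by have := lt_trans h (g_gt j); rewrite ltxx.
  by have := lt_trans h (g_lt j); rewrite ltxx.
Qed.
End limit_roots.

(** * The roots of the perturbed equation *)

(** Two monotone lists of the same length k coincide as soon as one of them has
    distinct entries, all of which occur in the other. Exhibiting k distinct
    solutions in order therefore identifies the ordered roots; no upper bound
    on the number of solutions has to be proved. *)
Lemma ordered_roots_unique (R : realType) (k : nat) (E : R -> Prop)
    (l y : 'I_k -> R) : ordered_roots E l ->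
  (forall i j : 'I_k, (i < j)%N -> y j < y i) -> (forall i, E (y i)) -> l =1 y.
Proof.
move=> [l_mono l_roots] y_decr yE.
have y_inj : injective y.
  move=> i j ij; case: (ltngtP i j) => [/y_decr|/y_decr|/ord_inj//];
    by rewrite ij ltxx.
have sub : {subset map y (enum 'I_k) <= map l (enum 'I_k)}.
  move=> _ /mapP[i _ ->]; have /l_roots[j ->] := yE i.
  by rewrite map_f ?mem_enum.
have uy : uniq (map y (enum 'I_k)) by rewrite map_inj_uniq ?enum_uniq.
have sz : (size (map l (enum 'I_k)) <= size (map y (enum 'I_k)))%N.
  by rewrite !size_map.
have [szE memE] := uniq_min_size uy sub sz.
have ul : uniq (map l (enum 'I_k)) by rewrite -(eq_uniq szE memE).
have sorted_map f : (forall i j : 'I_k, (i <= j)%N -> f j <= f i) ->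
    sorted >=%R (map f (enum 'I_k)).
  move=> f_mono; rewrite sorted_map.
  apply: (sub_sorted (e := relpre val ltn)) => [i j /ltnW/f_mono//|].
  by rewrite -sorted_map val_enum_ord iota_ltn_sorted.
have : map l (enum 'I_k) = map y (enum 'I_k).
  apply: (sorted_eq (leT := >=%R)) => //.
  - exact: ge_trans.
  - by move=> u v /andP[? ?]; apply/eqP; rewrite eq_le; apply/andP.
  - exact: sorted_map.
  - apply: sorted_map => i j; rewrite leq_eqVlt => /predU1P[/ord_inj->//|/y_decr/ltW//].
  - by rewrite perm_sym; apply: uniq_perm.
by move=> /eq_in_map eqly i; apply: eqly; rewrite mem_enum.
Qed.

Section perturbation.
Context {R : realType} {n : nat} (a : R) (mu r : 'I_n.+1 -> R).
Hypothesis a_neq0 : a != 0.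
Hypothesis r_decr : forall i j : 'I_n.+1, (i < j)%N -> r j < r i.
Hypothesis r_root : forall k, limit_equation mu a (r k).

Let near0_mul (M e : R) : 0 < e -> \forall eta \near 0^'+, eta * M < e.
Proof.
move=> e0; near=> eta.
have eta0 : 0 < eta by near: eta; exact: nbhs_right_gt.
apply: (@le_lt_trans _ _ (eta * (`|M| + 1))).
  by rewrite ler_pM2l//; apply: le_trans (ler_norm _) _; rewrite lerDl.
rewrite -ltr_pdivlMr; last by rewrite ltr_wpDl.
by near: eta; apply: nbhs_right_lt; rewrite divr_gt0// ltr_wpDl.
Unshelve. all: by end_near. Qed.

(** With t = 2 / b, z = t * xi_N and c_i = t * xi_i, this is the event on which
    the rescaled coefficients of the equation are near their limits. A single
    eta also bounds t, so that every largeness condition on b becomes a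
    statement about eta near 0. *)
Definition closeness (eta t z : R) (c : 'I_n.+1 -> R) :=
  [/\ 0 < t < eta, `|z - a| < eta & forall i, `|c i - 1| < eta].

Local Notation F t z c := (fun x => t * x - z - pole_sum c mu x).

Lemma corner_fun_close eta t z c x : closeness eta t z c ->
  `|F t z c x - (- a - pole_sum (fun=> 1) mu x)| <=
  eta * (`|x| + 1 + \sum_i `|(x - mu i)^-1|).
Proof.
move=> [/andP[t0 te] ze ce].
have -> : F t z c x - (- a - pole_sum (fun=> 1) mu x) =
    t * x - (z - a) - \sum_i (c i - 1) * (x - mu i)^-1.
  under eq_bigr do rewrite mulrBl; rewrite sumrB /pole_sum; ring.
rewrite !mulrDr mulr1; apply: le_trans (ler_normB _ _) _; apply: lerD.
  apply: le_trans (ler_normB _ _) _; apply: lerD; last exact: ltW.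
  by rewrite normrM gtr0_norm// ler_wpM2r// ltW.
apply: le_trans (ler_norm_sum _ _ _) _; rewrite mulr_sumr.
by apply: ler_sum => i _; rewrite normrM ler_wpM2r// ltW.
Qed.

(** Away from the poles the rescaled corner function tends to
    G = - a - pole_sum, uniformly over closeness, so that it inherits the sign
    of G at each fixed point where G is nonzero. *)
Lemma corner_fun_sign x (G := - a - pole_sum (fun=> 1) mu x) : G != 0 ->
  \forall eta \near 0^'+, forall t z c, closeness eta t z c ->
    0 < G * F t z c x.
Proof.
move=> G0; pose M := `|x| + 1 + \sum_i `|(x - mu i)^-1|.
have G0' : 0 < `|G| by rewrite normr_gt0.
apply: filterS (near0_mul M G0') => eta eM t z c.
move=> /(corner_fun_close x) /le_lt_trans/(_ eM).
rewrite -/G; move: (F t z c x) G0 => f G0; rewrite ltr_norml => /andP[h1 h2].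
case: (ltgtP G 0) G0 h1 h2 => // G0 _.
  by rewrite ltr0_norm// nmulr_rgt0//; lra.
by rewrite gtr0_norm// pmulr_rgt0//; lra.
Qed.

(** Around each limiting root take an interval of half-width d that contains no
    pole and is disjoint from the other intervals. The limit function increases
    strictly between poles, hence has opposite signs at the two ends, and these
    signs persist. *)
Lemma small_roots e : 0 < e ->
  \forall eta \near 0^'+, forall t z c, closeness eta t z c ->
    exists x : 'I_n.+1 -> R,
    [/\ forall k, `|x k - r k| < e,
        forall i j : 'I_n.+1, (i < j)%N -> x j < x i &
        forall k, (forall i, x k != mu i) /\ F t z c (x k) = 0].
Proof.
move=> e0.
have rmu k i : 0 < `|r k - mu i|.
  by rewrite normr_gt0 subr_eq0; case: (r_root k).
near (0:R)^'+ => d.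
have d0 : 0 < d by near: d; exact: nbhs_right_gt.
have de : d < e by near: d; exact: nbhs_right_lt.
have dmu k i : d < `|r k - mu i|.
  move: k i; near: d; apply: filter_forall => k; apply: filter_forall => i.
  exact: nbhs_right_lt.
have dr (i j : 'I_n.+1) : (i < j)%N -> d < (r i - r j) / 2.
  move: i j; near: d; apply: filter_forall => i; apply: filter_forall => j.
  case: ltnP => [/r_decr ij|_]; last by apply: nearW.
  by apply: filterS (nbhs_right_lt _) => [? ? _|];
    [eassumption|rewrite divr_gt0// subr_gt0].
have free k s s' : `|s| <= d -> `|s'| <= d -> pole_free mu (r k + s) (r k + s').
  move=> sd s'd i; have := dmu k i.
  move: sd s'd; rewrite !ler_norml => /andP[s1 s2] /andP[t1 t2].
  rewrite ltr_normr => /orP[h|h].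
    by rewrite mulr_gt0//; lra.
  by rewrite -mulrNN mulr_gt0//; lra.
have dd : `|d| <= d by rewrite gtr0_norm.
have Ndd : `|-d| <= d by rewrite normrN.
have zd : `|0 : R| <= d by rewrite normr0 ltW.
have rk k : pole_sum (fun=> 1) mu (r k) = - a by case: (r_root k).
have Gu k : - a - pole_sum (fun=> 1) mu (r k - d) < 0.
  have := @pole_sum_decr _ _ mu (r k - d) (r k + 0) isT (free k _ _ Ndd zd).
  by rewrite addr0 rk gtrBl d0 => /(_ isT); lra.
have Gv k : 0 < - a - pole_sum (fun=> 1) mu (r k + d).
  have := @pole_sum_decr _ _ mu (r k + 0) (r k + d) isT (free k _ _ zd dd).
  by rewrite addr0 rk ltrDl d0 => /(_ isT); lra.
have nearu : \forall eta \near 0^'+, forall k t z c, closeness eta t z c ->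
    0 < (- a - pole_sum (fun=> 1) mu (r k - d)) * F t z c (r k - d).
  by apply: filter_forall => k; apply: corner_fun_sign; rewrite lt_eqF.
have nearv : \forall eta \near 0^'+, forall k t z c, closeness eta t z c ->
    0 < (- a - pole_sum (fun=> 1) mu (r k + d)) * F t z c (r k + d).
  by apply: filter_forall => k; apply: corner_fun_sign; rewrite gt_eqF.
apply: filterS2 nearu nearv => eta hu hv t z c tzc.
have Fu k : F t z c (r k - d) < 0 by have := hu k t z c tzc; rewrite nmulr_rgt0.
have Fv k : 0 < F t z c (r k + d) by have := hv k t z c tzc; rewrite pmulr_rgt0.
have /choice[x xP] : forall k, exists x,
    [/\ r k - d < x < r k + d, forall i, x != mu i & F t z c x = 0].
  by move=> k; apply: pole_free_ivt; [exact: free|lra|exact: Fu|exact: Fv].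
exists x; split => [k|i j ij|k]; last by case: (xP k).
- by case: (xP k) => /andP[h1 h2] _ _; rewrite (lt_trans _ de)// ltr_norml; lra.
- case: (xP i) => /andP[h1 _] _ _; case: (xP j) => /andP[_ h2] _ _.
  have := dr _ _ ij; lra.
Unshelve. all: by end_near. Qed.

(** At points x with t x close to a the pole terms are of order t, since the
    poles are negligible compared with |x|, which is of order 1 / t; the rescaled
    corner function is thus close to t x - a. It therefore changes sign between
    (a - d) / t and (a + d) / t, which lie beyond any bound M on the side of the
    sign of a. *)
Lemma big_root e M : 0 < e ->
  \forall eta \near 0^'+, forall t z c, closeness eta t z c ->
    exists x, [/\ `|t * x - a| < e, M < Num.sg a * x,
      forall i, x != mu i & F t z c x = 0].
Proof.
move=> e0; have a0 : 0 < `|a| by rewrite normr_gt0.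
pose d := Num.min e `|a| / 2.
have min0 : 0 < Num.min e `|a| by rewrite lt_min e0.
have d0 : 0 < d by rewrite divr_gt0.
have de : d < e.
  have : Num.min e `|a| <= e by rewrite ge_min lexx.
  by rewrite /d; lra.
have da : d <= `|a| / 2 by rewrite ler_pM2r// ge_min lexx orbT.
pose M0 := `|M| + \sum_i `|mu i|.
have muM0 i : `|mu i| <= M0.
  by rewrite /M0 (bigD1 i)//= addrCA lerDl addr_ge0 ?sumr_ge0.
have MM0 : `|M| <= M0 by rewrite lerDl sumr_ge0.
near=> eta => t z c [/andP[t0 te] ze ce].
have eta0 : 0 < eta by exact: lt_trans te.
have etaM : t * (4 * M0) < `|a|.
  apply: (@le_lt_trans _ _ (eta * (4 * M0))); last by near: eta; exact: near0_mul.
  by rewrite ler_wpM2r ?(ltW te)// mulr_ge0// (le_trans _ MM0).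
have etad : eta * (1 + n.+1%:R * 8 / `|a|) < d by near: eta; exact: near0_mul.
have eta1 : eta < 1 by near: eta; exact: nbhs_right_lt.
(* seen from x, all w of size at most M0 lie on the same side, at a distance of
   order 1 / t; used for the poles and for M *)
have far x w : `|t * x - a| <= d -> `|w| <= M0 -> `|a| / 4 < t * (Num.sg a * (x - w)).
  move=> txa wM0.
  have twM : `|t * w| <= t * M0 by rewrite normrM gtr0_norm// ler_pM2l.
  have -> : t * (Num.sg a * (x - w)) = Num.sg a * (t * x - t * w) by ring.
  have tM : t * M0 < `|a| / 4 by move: etaM; rewrite mulrCA; lra.
  move: txa twM; rewrite !ler_norml => /andP[h1 h2] /andP[h3 h4].
  case: (ltgtP a 0) a_neq0 tM da => // a0' _ tM da.
    by move: tM da; rewrite ltr0_sg// ltr0_norm//; lra.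
  by move: tM da; rewrite gtr0_sg// gtr0_norm//; lra.
have Fx x : `|t * x - a| <= d -> `|F t z c x - (t * x - a)| < d.
  move=> txa; have -> : F t z c x - (t * x - a) = - ((z - a) + pole_sum c mu x) by ring.
  rewrite normrN (le_lt_trans (ler_normD _ _))//; apply: le_lt_trans etad.
  rewrite mulrDr mulr1; apply: lerD; first exact: ltW.
  apply: le_trans (ler_norm_sum _ _ _) _.
  apply: (@le_trans _ _ (\sum_(i < n.+1) (eta * (8 / `|a|)))); last first.
    by rewrite sumr_const card_ord -[leLHS]mulr_natl; lra.
  apply: ler_sum => i _; rewrite normrM normfV.
  have h : `|a| / 4 < t * `|x - mu i|.
    apply: lt_le_trans (far x (mu i) txa (muM0 i)) _; rewrite ler_pM2l//.
    by rewrite (le_trans (ler_norm _))// normrM normr_sg a_neq0 mul1r.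
  have xmu0 : 0 < `|x - mu i|.
    by rewrite -(pmulr_rgt0 _ t0); apply: lt_trans h; rewrite divr_gt0.
  have c2 : `|c i| <= 2.
    by have := ce i; rewrite ltr_norml ler_norml => /andP[h1 h2]; apply/andP; lra.
  rewrite ler_pdivrMr// (le_trans c2)//.
  have -> : eta * (8 / `|a|) * `|x - mu i| = (8 / `|a|) * (eta * `|x - mu i|) by ring.
  have -> : 2 = (8 / `|a|) * (`|a| / 4) by field; rewrite gt_eqF.
  rewrite ler_pM2l ?divr_gt0// (le_trans (ltW h))// ler_pM2r// ltW//.
pose u := (a - d) / t; pose v := (a + d) / t.
have tu : t * u = a - d by rewrite /u mulrC divfK// gt_eqF.
have tv : t * v = a + d by rewrite /v mulrC divfK// gt_eqF.
have ud : `|t * u - a| <= d by rewrite tu addrAC subrr add0r normrN gtr0_norm.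
have vd : `|t * v - a| <= d by rewrite tv addrAC subrr add0r gtr0_norm.
have [||||x [/andP[ux xv] xmu Fx0]] := @pole_free_ivt _ _ c mu t z u v.
- move=> i; have := far u (mu i) ud (muM0 i); have := far v (mu i) vd (muM0 i).
  move=> /(lt_trans (divr_gt0 a0 _)) hv /(lt_trans (divr_gt0 a0 _)) hu.
  have -> : (u - mu i) * (v - mu i) =
      (Num.sg a * (u - mu i)) * (Num.sg a * (v - mu i)).
    by rewrite mulrACA -expr2 sqr_sg a_neq0 mul1r.
  by rewrite mulr_gt0// -(pmulr_rgt0 _ t0) ?hu ?hv.
- by rewrite ltr_pM2r ?invr_gt0//; lra.
- by have := Fx _ ud; rewrite tu ltr_norml; lra.
- by have := Fx _ vd; rewrite tv ltr_norml; lra.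
have txd : `|t * x - a| <= d.
  have h1 : t * u < t * x by rewrite ltr_pM2l.
  have h2 : t * x < t * v by rewrite ltr_pM2l.
  by rewrite ler_norml; lra.
exists x; split => //; first exact: le_lt_trans txd de.
have sM : `|Num.sg a * M| <= M0 by rewrite normrM normr_sg a_neq0 mul1r.
have := far x _ txd sM.
rewrite mulrBr mulrA -expr2 sqr_sg a_neq0 mul1r => /(lt_trans (divr_gt0 a0 _)) h.
by rewrite -subr_gt0 -(pmulr_rgt0 _ t0) h.
Unshelve. all: by end_near. Qed.

Definition escape_index : 'I_n.+2 := if 0 < a then ord0 else ord_max.

(** The n + 1 roots near the limiting roots together with the one near a / t are
    n + 2 ordered distinct solutions, hence all the entries of l. The last
    conclusion says that the escaping root dominates the others and has the
    sign of a. *)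
Lemma corner_roots e : 0 < e ->
  \forall eta \near 0^'+, forall t (xi l : 'I_n.+2 -> R), 0 < t < eta ->
    (forall j, `|t * xi j - (if j == ord_max then a else 1)| < eta) ->
    ordered_roots (corner_equation mu xi) l ->
    [/\ forall k, `|l (lift escape_index k) - r k| < e,
        `|t * l escape_index - a| < e &
        forall k, `|l (lift escape_index k)| < Num.sg a * l escape_index].
Proof.
move=> e0; pose M := \sum_k `|r k| + 1.
have m0 : 0 < Num.min e 1 by rewrite lt_min e0 ltr01.
apply: filterS2 (small_roots m0) (big_root M e0).
move=> eta small big t xi l t0 xi_close l_roots.
pose c (i : 'I_n.+1) := t * xi (widen_ord (leqnSn n.+1) i).
have close : closeness eta t (t * xi ord_max) c.
  split=> // [|i]; first by have := xi_close ord_max; rewrite eqxx.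
  have := xi_close (widen_ord (leqnSn n.+1) i); rewrite ifF//.
  by apply/negbTE; rewrite -(inj_eq val_inj)/= ltn_eqF// -ltnS.
have [x [xr x_decr xF]] := small _ _ _ close.
have [X [Xa MX Xmu XF]] := big _ _ _ close.
have tgt0 : 0 < t by case/andP: t0.
have rootE w : (forall i, w != mu i) -> F t (t * xi ord_max) c w = 0 ->
    corner_equation mu xi w.
  move=> wmu Fw; split => //; apply: (mulfI (lt0r_neq0 tgt0)).
  rewrite mulr_sumr mulrBr; apply/esym/eqP; rewrite -subr_eq0 -[eqbRHS]Fw; apply/eqP.
  by congr (_ - _); apply: eq_bigr => i _; rewrite mulrA.
pose y j := if unlift escape_index j is Some k then x k else X.
have yX : y escape_index = X by rewrite /y unlift_none.
have yx k : y (lift escape_index k) = x k by rewrite /y liftK.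
have xM k : `|x k| < M.
  have x1 : `|x k - r k| < 1 by have := xr k; rewrite lt_min => /andP[_].
  have rM : `|r k| <= \sum_i `|r i| by rewrite (bigD1 k)//= lerDl sumr_ge0.
  by have := ler_normD (x k - r k) (r k); rewrite subrK /M; lra.
have xX k : `|x k| < Num.sg a * X by exact: lt_trans (xM k) MX.
have y_decr (i j : 'I_n.+2) : (i < j)%N -> y j < y i.
  case: (unliftP escape_index i) => [i'|] ->;
    case: (unliftP escape_index j) => [j'|] ->;
    rewrite ?yx ?yX ?ltnn//.
  - by rewrite /lift/= => ij; apply: x_decr; move: ij; rewrite ltnNge leq_bump2 -ltnNge.
  - rewrite /escape_index; case: ifP => // a0 _.
    have a_lt0 : a < 0 by rewrite lt_neqAle a_neq0 leNgt a0.
    have := xX i'; rewrite ltr0_sg// mulN1r ltr_norml => /andP[]; rewrite opprK//.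
  - rewrite /escape_index; case: ifP => [a0 _|_]; last first.
      by rewrite lift_max/= ltnNge ltnW.
    by have := xX j'; rewrite gtr0_sg// mul1r ltr_norml => /andP[].
have ly : l =1 y.
  apply: (ordered_roots_unique l_roots y_decr) => j.
  case: (unliftP escape_index j) => [k|] ->; rewrite ?yx ?yX; apply: rootE => //;
    by case: (xF k).
split=> [k||k]; rewrite !ly ?yx ?yX//.
by apply: lt_le_trans (xr k) _; rewrite ge_min lexx.
Qed.

End perturbation.

(** * Vanishing probabilities *)

Lemma ae_union_bound d (T : measurableType d) (R : realType)
    (P : probability T R) (J : finType) (bad : J -> set T) (A : set T) :
  (forall j, measurable (bad j)) -> measurable A ->
  {ae P, forall w, A w -> exists j, bad j w} ->
  (P A <= \sum_j P (bad j))%E.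
Proof.
move=> mbad mA [N [mN N0 AN]].
have mU r : measurable (\big[setU/set0]_(j <- r) bad j).
  by apply: bigsetU_measurable => j _; exact: mbad.
apply: (@le_trans _ _ (P (N `|` \big[setU/set0]_(j : J) bad j))).
  apply: le_measure; rewrite ?inE//; first exact: measurableU.
  move=> w Aw; case: (pselect (exists j, bad j w)) => [[j jw]|nj]; last first.
    by left; apply: AN => /= H; apply: nj; exact: H.
  by right; rewrite (bigD1 j)//=; left.
apply: (@le_trans _ _ (P N + P (\big[setU/set0]_(j : J) bad j))%E).
  exact: measureU2.
rewrite N0 add0e.
elim: (index_enum J) => [|j r IH]; first by rewrite !big_nil measure0.
rewrite !big_cons; apply: (@le_trans _ _
    (P (bad j) + P (\big[setU/set0]_(i <- r) bad i))%E).
  exact: measureU2.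
exact: leeD2l.
Qed.

Section vanishing.
Context {R : realType}.

Lemma le_inv_cvg0 (f : R -> \bar R) (C : R) :
  (forall b, 2 < b -> (0 <= f b <= (C / b)%:E)%E) ->
  f b @[b --> +oo] --> 0%E.
Proof.
move=> fC.
apply: (@squeeze_cvge _ _ _ _ (fun=> 0%E) f (fun b => (C / b)%:E)).
- by near=> b; apply: fC; near: b; exact: nbhs_pinfty_gt.
- exact: cvg_cst.
apply/cvg_EFin; first by near=> b.
rewrite -[X in _ --> X](mulr0 C); apply: cvgMr.
apply/gtr0_cvgV0; [by near=> b; near: b; exact: nbhs_pinfty_gt|exact: cvg_id].
Unshelve. all: by end_near. Qed.

Context {d : measure_display} {T : R -> measurableType d}
  {P : forall b, probability (T b) R}.

(** How a deterministic statement transfers to probabilities: if the events A b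
    are almost surely covered by finitely many vanishing events, they vanish. *)
Lemma ae_covered_cvg0 (J : finType) (bad : forall b, J -> set (T b))
    (A : forall b, set (T b)) (B : R) :
  (forall b j, measurable (bad b j)) -> (forall b, measurable (A b)) ->
  (forall j, P b (bad b j) @[b --> +oo] --> 0%E) ->
  (forall b, B < b -> {ae P b, forall w, A b w -> exists j, bad b j w}) ->
  P b (A b) @[b --> +oo] --> 0%E.
Proof.
move=> mbad mA bad0 cover.
apply: (@squeeze_cvge _ _ _ _ (fun=> 0%E) _ (fun b => \sum_j P b (bad b j))%E).
- near=> b; rewrite measure_ge0/=; apply: ae_union_bound => //; apply: cover.
  by near: b; apply: nbhs_pinfty_gt; exact: num_real.
- exact: cvg_cst.
suff : (\sum_j P b (bad b j))%E @[b --> +oo] --> (\sum_(j : J) 0)%E by rewrite big1.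
by apply: cvg_nnesum => j _; [apply: nearW => b; exact: measure_ge0|exact: bad0].
Unshelve. all: by end_near. Qed.

Lemma cvg0_prob_tends_to_1 (E : forall b, set (T b)) :
  (forall b, measurable (E b)) -> P b (~` E b) @[b --> +oo] --> 0%E ->
  prob_tends_to_1 P E.
Proof.
move=> mE E0; rewrite /prob_tends_to_1.
have -> : (fun b => P b (E b)) = (fun b => 1 - P b (~` E b))%E.
  by apply/funext => b; rewrite -(probability_setC _ (measurableC (mE b))) setCK.
rewrite -[X in _ --> X]sube0; apply: cvgeB => //; exact: cvg_cst.
Qed.

Lemma half_chi2_cvg (X : forall b, {RV (P b) >-> R}) :
  (forall b, 0 < b -> has_law (X b) (half_chi2_prob b)) ->
  cvg_in_probability P (fun b w => 2 / b * X b w) 1.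
Proof.
move=> law e e0; apply: (@le_inv_cvg0 _ (2 / e ^+ 2)) => b b2.
have b0 : 0 < b by lra.
rewrite measure_ge0/=.
have tot : half_chi2_prob b setT = 1%E.
  by rewrite -law// /distribution /pushforward preimage_setT probability_setT.
have := half_chi2_concentration b2 e0 tot.
rewrite -law//; last by apply: measurable_dist_ge; exact: measurable_funM.
by rewrite mulrAC.
Qed.

Lemma normal_cvg (a : R) (X : forall b, {RV (P b) >-> R}) :
  (forall b, 0 < b -> has_law (X b) (normal_prob (b / 2 * a) 1)) ->
  cvg_in_probability P (fun b w => 2 / b * X b w) a.
Proof.
move=> law e e0; have [C C0 tail] := @normal_tail R.
apply: (@le_inv_cvg0 _ (4 * C / e ^+ 2)) => b b2.
have b0 : 0 < b by lra.
rewrite measure_ge0/=.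
have b20 : 0 < b / 2 by rewrite divr_gt0.
have K0 : 0 < e * (b / 2) by rewrite mulr_gt0.
have := tail (b / 2 * a) _ K0.
rewrite -law//; last exact: measurable_dist_ge.
have -> : [set x : R | e * (b / 2) <= `|x - b / 2 * a|] =
    [set x : R | e <= `|2 / b * x - a|].
  apply/seteqP; split => x /=;
    (have -> : x - b / 2 * a = (b / 2) * (2 / b * x - a) by field; rewrite gt_eqF//);
    by rewrite normrM (gtr0_norm b20) [e * _]mulrC ler_pM2l.
move=> h; apply: le_trans h _; rewrite lee_fin.
have -> : C / (e * (b / 2)) ^+ 2 = 4 * C / e ^+ 2 / b * b^-1.
  by field; rewrite !gt_eqF.
rewrite ler_piMr//; last by rewrite invf_le1//; lra.
by rewrite !divr_ge0 ?sqr_ge0 ?mulr_ge0// ltW.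
Qed.

End vanishing.

Lemma measurable_bigmax d (T : measurableType d) (R : realType) (I : Type)
    (s : seq I) (f : I -> T -> R) :
  (forall i, measurable_fun setT (f i)) ->
  measurable_fun setT (fun w => \big[Num.max/0]_(i <- s) f i w).
Proof.
move=> mf; elim: s => [|i s IH].
  by under eq_fun do rewrite big_nil; exact: measurable_cst.
by under eq_fun do rewrite big_cons; exact: measurable_maxr.
Qed.

Lemma sg_eqP (R : realDomainType) (a x : R) : a != 0 ->
  Num.sg x = Num.sg a <-> 0 < Num.sg a * x.
Proof.
move=> a0; case: (ltgtP a 0) a0 => // a0 _.
  rewrite (ltr0_sg a0) mulN1r oppr_gt0; split=> [/eqP|/ltr0_sg//].
  by rewrite sgr_cp0.
by rewrite (gtr0_sg a0) mul1r; split=> [/eqP|/gtr0_sg//]; rewrite sgr_cp0.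
Qed.

Lemma measurable_sg_eq d (T : measurableType d) (R : realType) (f : T -> R) (a : R) :
  a != 0 -> measurable_fun setT f -> measurable [set w | Num.sg (f w) = Num.sg a].
Proof.
move=> a0 mf; rewrite (_ : mkset _ = ~` [set w | Num.sg a * f w <= 0]).
  apply: measurableC; rewrite -[X in measurable X]setTI.
  apply: (@measurable_fun_le _ _ R setT _ (cst 0)) => //.
  exact: measurable_funM.
apply/seteqP; split => w /=; first by move=> /(sg_eqP _ a0); rewrite ltNge => /negP.
by move=> h; apply/(sg_eqP _ a0); rewrite ltNge; apply/negP.
Qed.

Unset Implicit Arguments.

(** * Asymptotics of the ordered roots *)

Theorem proposition6p2 (R : realType) (n : nat) (a : R) (mu : 'I_n.+1 -> R)
    (d : measure_display) (T : R -> measurableType d)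
    (P : forall b : R, probability (T b) R)
    (xi lambda : forall b : R, 'I_n.+2 -> {RV (P b) >-> R})
    (a_neq0 : a != 0)
    (mu_decr : forall i j : 'I_n.+1, (i < j)%N -> mu j < mu i)
    (xi_indep : forall b : R, 0 < b -> mutually_independent (xi b))
    (xi_chi2 : forall b : R, 0 < b -> forall i : 'I_n.+1,
       has_law (xi b (widen_ord (leqnSn n.+1) i)) (half_chi2_prob b))
    (xi_normal : forall b : R, 0 < b ->
       has_law (xi b ord_max) (normal_prob (b / 2 * a) 1))
    (lambda_roots : forall b : R, 0 < b ->
       {ae P b, forall w, ordered_roots
          (corner_equation mu (fun i => xi b i w)) (fun j => lambda b j w)}) :
  (forall x : R, limit_equation mu a x <->
     root ((Pmu mu)^`() + a *: Pmu mu) x) /\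
  exists (r : 'I_n.+1 -> R) (j0 : 'I_n.+2),
    (* (i) *)
    [/\ ordered_roots (limit_equation mu a) r,
        forall k : 'I_n.+1,
          (exists M : R, prob_tends_to_1 P
             (fun b => [set w | `|lambda b (lift j0 k) w| <= M])) /\
          cvg_in_probability P (fun b => lambda b (lift j0 k)) (r k),
        forall i : 'I_n, exists! k : 'I_n.+1,
          mu (lift ord0 i) < r k < mu (widen_ord (leqnSn n) i) &
        exists! k : 'I_n.+1,
          if 0 < a then r k < mu ord_max else mu ord0 < r k] /\
    (* (ii) *)
    [/\ cvg_in_probability P
          (fun b w => 2 / b * \big[Num.max/0]_(j < n.+2) `|lambda b j w|) `|a|,
        cvg_in_probability P
          (fun b w => 2 / b * `|lambda b j0 w|) `|a| &
        prob_tends_to_1 P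
          (fun b => [set w | Num.sg (lambda b j0 w) = Num.sg a])].
Proof.
split; first by move=> x; exact: limit_equationP.
have [r [r_decr r_roots r_gap r_out]] := limit_roots a_neq0 mu_decr.
pose j0 := escape_index (n := n) a; exists r, j0.
have r_root k : limit_equation mu a (r k) by apply/(proj2 r_roots); exists k.
pose c (j : 'I_n.+2) : R := if j == ord_max then a else 1.
have xi_cvg j : cvg_in_probability P (fun b w => 2 / b * xi b j w) (c j).
  rewrite /c; case: (unliftP ord_max j) => [i|] ->; last first.
    by rewrite eqxx; exact: normal_cvg.
  rewrite eq_sym (negbTE (neq_lift _ _)).
  have -> : lift ord_max i = widen_ord (leqnSn n.+1) i.
    by apply: val_inj; rewrite /= /bump leqNgt ltn_ord.
  by apply: half_chi2_cvg => b b0; exact: xi_chi2.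
(* the conclusion of corner_roots at the outcome w *)
pose close e b w := [/\ forall k, `|lambda b (lift j0 k) w - r k| < e,
    `|2 / b * lambda b j0 w - a| < e &
    forall k, `|lambda b (lift j0 k) w| < Num.sg a * lambda b j0 w].
(* an event that excludes closeness has vanishing probability, as one of the
   coefficients must then deviate from its limit *)
have main e (A : forall b, set (T b)) : 0 < e ->
    (forall b, measurable (A b)) ->
    (forall b w, 0 < b -> close e b w -> ~ A b w) ->
    P b (A b) @[b --> +oo] --> 0%E.
  move=> e0 mA closeA.
  near (0 : R)^'+ => eta.
  have eta0 : 0 < eta by near: eta; exact: nbhs_right_gt.
  have roots : forall t (x l : 'I_n.+2 -> R), 0 < t < eta ->
      (forall j, `|t * x j - c j| < eta) ->
      ordered_roots (corner_equation mu x) l ->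
      [/\ forall k, `|l (lift j0 k) - r k| < e,
        `|t * l j0 - a| < e &
        forall k, `|l (lift j0 k)| < Num.sg a * l j0].
    by near: eta; exact: corner_roots.
  apply: (@ae_covered_cvg0 _ _ _ P 'I_n.+2
    (fun b j => [set w | eta <= `|2 / b * xi b j w - c j|]) A (2 / eta)) => //.
  - by move=> b j; apply: measurable_dist_ge; exact: measurable_funM.
  - by move=> j; exact: xi_cvg.
  move=> b etab; have b0 : 0 < b by apply: lt_trans etab; rewrite divr_gt0.
  apply: filterS (lambda_roots b b0) => w l_roots Aw.
  apply: contrapT => no_bad; apply: (closeA b w b0 _ Aw).
  apply: roots l_roots; first by rewrite divr_gt0// ltr_pdivrMr// mulrC -ltr_pdivrMr.
  by move=> j; rewrite ltNge; apply/negP => h; apply: no_bad; exists j.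
have lambda_sg e b w : close e b w -> Num.sg (lambda b j0 w) = Num.sg a.
  by move=> [_ _ /(_ ord0)/(le_lt_trans (normr_ge0 _)) h]; exact/sg_eqP.
have lambda_max e b w : close e b w ->
    \big[Num.max/0]_(j < n.+2) `|lambda b j w| = `|lambda b j0 w|.
  move=> h; have := lambda_sg _ _ _ h; case: h => _ _ h sgl.
  apply/eqP; rewrite eq_le; apply/andP; split; last exact: le_bigmax.
  apply: bigmax_le => // j _; case: (unliftP j0 j) => [k|] -> //.
  by rewrite [leRHS]normrEsg sgl ltW.
have lambda_norm e b w : 0 < b -> close e b w ->
    `|2 / b * `|lambda b j0 w| - `|a| | < e.
  move=> b0 [_ h _]; apply: le_lt_trans h.
  have -> : 2 / b * `|lambda b j0 w| = `|2 / b * lambda b j0 w|.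
    by rewrite normrM (@ger0_norm _ (2 / b))// divr_ge0// ltW.
  exact: ler_dist_dist.
split; split => //.
- move=> k; split.
    have mbound b : measurable [set w | `|lambda b (lift j0 k) w| <= `|r k| + 1].
      rewrite -[X in measurable X]setTI.
      apply: (@measurable_fun_le _ _ R setT _ (cst (`|r k| + 1))) => //.
      exact: measurableT_comp.
    exists (`|r k| + 1); apply: cvg0_prob_tends_to_1.
      by move=> b; exact: mbound.
    apply: (main 1) => //; first by move=> b; apply: measurableC; exact: mbound.
    move=> b w _ [h _ _]; apply; apply/ltW.
    have := ler_normD (lambda b (lift j0 k) w - r k) (r k).
    by rewrite subrK; have := h k; lra.
  move=> e e0; apply: (main e) => //.
    by move=> b; exact: measurable_dist_ge.
  by move=> b w _ [h _ _] /=; rewrite leNgt h.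
- move=> e e0; apply: (main e) => //.
    move=> b; apply: measurable_dist_ge; apply: measurable_funM => //.
    apply: measurable_bigmax => j; exact: measurableT_comp.
  by move=> b w b0 h /=; rewrite (lambda_max _ _ _ h) leNgt (lambda_norm _ _ _ b0 h).
- move=> e e0; apply: (main e) => //.
    move=> b; apply: measurable_dist_ge; apply: measurable_funM => //.
    exact: measurableT_comp.
  by move=> b w b0 h /=; rewrite leNgt (lambda_norm _ _ _ b0 h).
- apply: cvg0_prob_tends_to_1.
    by move=> b; exact: measurable_sg_eq.
  apply: (main 1) => //.
    by move=> b; apply: measurableC; exact: measurable_sg_eq.
  by move=> b w b0 h; apply; exact: lambda_sg h.
Unshelve. all: by end_near. Qed.
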